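(* Let $X$ be an arbitrary subspace of a Tychonoff space $Y$. Then the natural mapping $\hat{e}_{X,Y}: AP(X)\rightarrow AP(Y)$ is a topological monomorphism if and only if $X$ is quasi-P$^{\ast}$-embedded in $Y$.
   Context: A paratopological group is a group with a topology for which multiplication is jointly continuous. For a space $X$, the Markov free Abelian paratopological group $AP(X)$ is an Abelian paratopological group containing $X$ as a subspace such that $X$ generates $AP(X)$ algebraically and each continuous mapping $f:X\to H$ to an Abelian paratopological group $H$ extends to a continuous homomorphism $\hat f:AP(X)\to H$; its underlying group is the free Abelian group on $X$. For $X\subset Y$, $e_{X,Y}:X\to Y$ is the inclusion and $\hat e_{X,Y}:AP(X)\to AP(Y)$ is the continuous homomorphism (which is a monomorphism) extending it. A topological monomorphism is a monomorphism of groups that is also a topological embedding. A quasi-uniformity is defined like a uniformity, with the symmetry axiom dropped. For a quasi-uniformity $\mathscr{U}$ on $X$, $\mathscr{U}^{-1}=\{U^{-1}:U\in\mathscr{U}\}$ with $U^{-1}=\{(y,x):(x,y)\in U\}$, and $\mathscr{U}$ generates the topology $\tau(\mathscr{U})$ in which the sets $\{y:(x,y)\in U\}$, $U\in\mathscr{U}$, form a neighborhood base at $x$. The universal quasi-uniformity $\mathscr{U}_X$ of a space $X$ is the finest quasi-uniformity on $X$ inducing the original topology of $X$. A quasi-pseudometric on $X$ is a function $d:X\times X\to[0,\infty)$ with $d(x,x)=0$ and $d(x,y)\le d(x,z)+d(z,y)$ for all $x,y,z\in X$. $\mathscr{U}^{\star}$ is the upper quasi-uniformity on $\mathbb{R}$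 with base the sets $\{(x,y)\in\mathbb{R}\times\mathbb{R}: y<x+r\}$, $r>0$. A quasi-pseudometric $d$ is continuous from $(X\times X,\mathscr{U}_X^{-1}\times\mathscr{U}_X)$ to $(\mathbb{R},\mathscr{U}^{\star})$ if it is continuous with respect to the topologies generated by these quasi-uniformities (the product topology $\tau(\mathscr{U}_X^{-1})\times\tau(\mathscr{U}_X)$ on $X\times X$). A subspace $X$ of a Tychonoff space $Y$ is quasi-P$^{\ast}$-embedded in $Y$ if each bounded quasi-pseudometric on $X$ that is continuous from $(X\times X,\mathscr{U}_X^{-1}\times\mathscr{U}_X)$ to $(\mathbb{R},\mathscr{U}^{\star})$ extends to a quasi-pseudometric on $Y$ that is continuous from $(Y\times Y,\mathscr{U}_Y^{-1}\times\mathscr{U}_Y)$ to $(\mathbb{R},\mathscr{U}^{\star})$. *)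

(* Defs.v *)
From HB Require Import structures.
From mathcomp Require Import all_boot all_order all_algebra.
From mathcomp Require Import all_classical all_reals all_analysis.

Set Implicit Arguments.
Unset Strict Implicit.
Unset Printing Implicit Defensive.

Import Order.TTheory GRing.Theory Num.Theory.
Import numFieldNormedType.Exports.

Local Open Scope classical_set_scope.
Local Open Scope relation_scope.
Local Open Scope ring_scope.

(* [completely_regular_space] is phrased with uniform separators; by
   [uniform_separatorP] this is separation of points from closed sets by
   continuous functions into [0, 1]. *)
Definition tychonoff_space (T : topologicalType) : Prop :=
  accessible_space T /\ completely_regular_space T.

Definition topological_embedding (S T : topologicalType) (f : S -> T) : Prop :=
  injective f /\ @open S = [set f @^-1` B | B in open].

Definition topological_monomorphism (G H : PreTopologicalZmodule.type)
  (f : {additive G -> H}) : Prop := topological_embedding f.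

(* Abelian groups are written additively; the inverse need not be continuous,
   so the library's [topologicalZmodType] is too strong, and no separation
   axiom is assumed. *)
Definition paratopological_group (G : PreTopologicalZmodule.type) : Prop :=
  continuous (fun x : G * G => x.1 + x.2).

(* [i : X -> A] exhibits [A] as the Markov free Abelian paratopological group
   AP(X); such a pair is unique up to a unique topological isomorphism. *)
Record markov_free_abelian (X : topologicalType)
    (A : PreTopologicalZmodule.type) (i : X -> A) : Prop := {
  markov_free_paratopological : paratopological_group A ;
  markov_free_embedding : topological_embedding i ;
  markov_free_generates : forall S : {pred A},
    zmod_closed S -> (forall x, i x \in S) -> forall a, a \in S ;
  markov_free_extension : forall (H : PreTopologicalZmodule.type) (f : X -> H),
    paratopological_group H -> continuous f ->
    exists2 g : {additive A -> H}, continuous g & forall x, g (i x) = f x }.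

Record quasi_uniformity (T : Type) (U : set_system (T * T)) : Prop := {
  quasi_uniformity_filter : Filter U ;
  quasi_uniformity_diagonal : forall A, U A -> diagonal `<=` A ;
  quasi_uniformity_split : forall A, U A -> exists2 B, U B & B \; B `<=` A }.

(* [nbhs_ U x], generated by the sets {y | (x, y) \in A} for A in U, is the
   neighborhood filter of x in the topology generated by U. *)
Definition compatible_quasi_uniformity (T : topologicalType) :
    set (set_system (T * T)) :=
  [set U | quasi_uniformity U /\ forall x : T, nbhs_ U x = nbhs x].

(* This union is itself the finest compatible quasi-uniformity: see
   [universal_quasi_uniformity_compatible] and
   [universal_quasi_uniformity_finest]. *)
Definition universal_quasi_uniformity (T : topologicalType) :
    set_system (T * T) :=
  \bigcup_(U in @compatible_quasi_uniformity T) U.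

Section UniversalQuasiUniformity.
Variable T : topologicalType.

Let normal_seq (A : set (T * T)) (B : (set (T * T))^nat) :=
  [/\ forall n, diagonal `<=` B n, forall n, B n.+1 \; B n.+1 `<=` B n,
      B 0%N `<=` A & forall n x, nbhs x (xsection (B n) x)].

Let fine : set_system (T * T) := [set A | exists B, normal_seq A B].

Let fine_quasi_uniformity : quasi_uniformity fine.
Proof.
split.
- split.
  + exists (fun=> setT); split=> // n x.
    by apply: filterS filterT => y _; rewrite /xsection /= inE.
  + move=> P Q [B [B1 B2 B3 B4]] [C [C1 C2 C3 C4]].
    exists (fun n => B n `&` C n); split.
    * by move=> n p dp; split; [exact: B1|exact: C1].
    * move=> n p [z [/= Bz Cz] [/= Bz' Cz']].
      by split; [apply: B2; exists z|apply: C2; exists z].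
    * by move=> p [/B3 ? /C3].
    * by move=> n x; rewrite xsectionI; exact: filterI.
  + move=> P Q PQ [B [B1 B2 B3 B4]]; exists B; split=> //.
    exact: subset_trans PQ.
- by move=> A [B [B1 _ BA _]]; exact: subset_trans (B1 0%N) BA.
- move=> A [B [B1 B2 BA B4]]; exists (B 1%N).
    by exists (fun n => B n.+1); split.
  exact: subset_trans (B2 0%N) BA.
Qed.

Let fine_compatible : compatible_quasi_uniformity fine.
Proof.
split=> // x; rewrite eqEsubset; split=> N.
  case=> A [B [_ _ BA Bx]] AN; apply: filterS (Bx 0%N x).
  by move=> y /xsectionP By; apply/AN/xsectionP/BA.
rewrite nbhsE => -[V [oV Vx] VN].
pose P := [set p : T * T | V p.1 -> V p.2].
exists P; last by move=> y /xsectionP /(_ Vx)/VN.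
exists (fun=> P); split=> //.
- by move=> n p dp Vp; rewrite -dp.
- by move=> n [a b] [z /= az zb] /az/zb.
- move=> n a; have [Va|nVa] := pselect (V a).
    apply: (@filterS _ _ _ V); last exact: open_nbhs_nbhs.
    by move=> y Vy; apply/xsectionP.
  by apply: filterS filterT => y _; apply/xsectionP.
Qed.

Let fine_finest U : compatible_quasi_uniformity U -> U `<=` fine.
Proof.
move=> [Uqu UE] A UA.
have half B : {C | U B -> U C /\ C \; C `<=` B}.
  apply: cid; have [UB|nUB] := pselect (U B); last by exists B.
  by have [C UC CB] := quasi_uniformity_split Uqu UB; exists C.
pose B n := iter n (fun B => projT1 (half B)) A.
have UB n : U (B n) by elim: n => //= n IH; have [] := projT2 (half (B n)) IH.
exists B; split=> //.
- by move=> n; exact: quasi_uniformity_diagonal (UB n).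
- by move=> n; have [] := projT2 (half (B n)) (UB n).
- by move=> n x; rewrite -UE; exists (B n).
Qed.

Lemma universal_quasi_uniformity_compatible :
  compatible_quasi_uniformity (@universal_quasi_uniformity T).
Proof.
have -> // : @universal_quasi_uniformity T = fine.
rewrite eqEsubset; split; first exact: bigcup_sub.
by move=> A fA; exists fine.
Qed.

Lemma universal_quasi_uniformity_finest U :
  compatible_quasi_uniformity U -> U `<=` @universal_quasi_uniformity T.
Proof. by move=> cU; exact: bigcup_sup. Qed.

End UniversalQuasiUniformity.

Record quasi_pseudometric (R : realType) (T : Type) (d : T -> T -> R) :
    Prop := {
  quasi_pseudometric_ge0 : forall x y, 0 <= d x y ;
  quasi_pseudometric_refl : forall x, d x x = 0 ;
  quasi_pseudometric_triangle : forall x y z, d x y <= d x z + d z y }.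

Definition upper_quasi_uniformity (R : realType) : set_system (R * R) :=
  filter_from [set r : R | 0 < r] (fun r => [set p | p.2 < p.1 + r]).

(* The source carries the product of the topologies generated by U_T^-1 and
   U_T, so the neighborhood filter of (x, y) is the [filter_prod] below. *)
Definition qu_continuous (R : realType) (T : topologicalType)
    (d : T -> T -> R) : Prop :=
  let UT := @universal_quasi_uniformity T in
  forall x y : T,
    (fun p : T * T => d p.1 p.2)
      @ filter_prod (nbhs_ [set A^-1%relation | A in UT] x) (nbhs_ UT y)
    --> nbhs_ (@upper_quasi_uniformity R) (d x y).

Definition quasi_Pstar_embedded (R : realType) (Y : topologicalType)
    (X : set Y) : Prop :=
  forall d : X -> X -> R,
    quasi_pseudometric d -> (exists M, forall x y, d x y <= M) ->
    qu_continuous d ->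
    exists dY : Y -> Y -> R, [/\ quasi_pseudometric dY, qu_continuous dY &
      forall x y : X, dY (\val x) (\val y) = d x y].

(* Main.v *)
(* A quasi-pseudometric d is continuous exactly when every ball {y | d x y < r}
   is a neighborhood of x.  Such a d on X makes the set of all finite sums
   sum_j (y_j - x_j) with sum_j d(x_j, y_j) < r a neighborhood of 0 in AP(X);
   conversely, a sequence of neighborhoods of 0 in AP(X) yields a subadditive
   function nu on AP(X), hence the continuous quasi-pseudometric
   d(x, y) = nu(y - x).  As every map of X into an indiscrete group extends to
   AP(X), the group AP(X) is free, and AP(X) -> AP(Y) is always injective.

   If X is quasi-P*-embedded, start from a neighborhood N of 0 in AP(X), take nu
   with {nu < 1/2} inside N, and extend d to Y.  A sum sum_j (y_j - x_j) that lies
   in AP(X) can be rewritten with all x_j, y_j in X without increasing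
   sum_j d(x_j, y_j), so the neighborhood of 0 in AP(Y) given by the extension
   meets AP(X) inside N.

   If AP(X) -> AP(Y) is an embedding and d is bounded on X, the neighborhoods of
   0 in AP(X) given by d are traces of neighborhoods in AP(Y); these yield a
   continuous quasi-pseudometric rho on Y with d <= rho on X, and
   min(rho(y, z), inf_(a, b in X) rho(y, a) + d(a, b) + rho(b, z)) extends d. *)

From HB Require Import structures.
Require Import Defs.
From mathcomp Require Import all_boot all_order all_algebra.
From mathcomp Require Import all_classical all_reals all_analysis.
From mathcomp Require Import zify ring lra.

Set Implicit Arguments.
Unset Strict Implicit.
Unset Printing Implicit Defensive.

Import Order.TTheory GRing.Theory Num.Theory.
Local Open Scope classical_set_scope.
Local Open Scope ring_scope.

(** * Group topologies given by a filter at 0 *)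

Record group_filter (G : zmodType) (W : set_system G) : Prop := {
  group_filter_filter : Filter W ;
  group_filter_zero : forall A, W A -> A 0 ;
  group_filter_split : forall A, W A ->
    exists2 B, W B & forall a b, B a -> B b -> A (a + b) }.

(** The type mentions [gfW], so that the instances below can recover the filter and its axioms from
    it. *)
Definition filtered_group (G : zmodType) (W : set_system G)
  (gfW : group_filter W) : Type := G.

Section FilteredGroup.
Variables (G : zmodType) (W : set_system G) (gfW : group_filter W).
Local Notation H := (filtered_group gfW).

HB.instance Definition _ := GRing.Zmodule.on H.

Definition filtered_group_nbhs (x : H) : set_system H :=
  [set A | W [set h | A (x + h)]].

HB.instance Definition _ := hasNbhs.Build H filtered_group_nbhs.

Let FW : Filter W. Proof. exact: group_filter_filter gfW. Qed.

Let nbhs_properfilter (x : H) : ProperFilter (nbhs x).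
Proof.
split; first by move=> /(group_filter_zero gfW).
split; rewrite /nbhs /= /filtered_group_nbhs /=.
- by apply: filterS filterT.
- by move=> P Q WP WQ; exact: (@filterI _ W _ _ _ WP WQ).
- by move=> P Q PQ; apply: (@filterS _ W FW) => h; exact: PQ.
Qed.

Let nbhs_self (x : H) (A : set H) : nbhs x A -> A x.
Proof. by move=> /(group_filter_zero gfW) /=; rewrite addr0. Qed.

Let nbhs_nbhsW (x : H) (A : set H) : nbhs x A -> nbhs x (nbhs^~ A).
Proof.
move=> /(group_filter_split gfW)[B WB BA].
apply: (@filterS _ W FW _ _ _ WB) => h Bh.
by apply: (@filterS _ W FW _ _ _ WB) => k Bk /=; rewrite -addrA; exact: BA.
Qed.

HB.instance Definition _ :=
  Nbhs_isNbhsTopological.Build H nbhs_properfilter nbhs_self nbhs_nbhsW.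

Lemma filtered_group_paratopological :
  paratopological_group (H : PreTopologicalZmodule.type).
Proof.
move=> [x y] A /(group_filter_split gfW)[B WB BA].
exists ([set z | B (z - x)], [set z | B (z - y)]); rewrite /nbhs /=.
  by split; apply: (@filterS _ W (group_filter_filter gfW) _ _ _ WB) => h /=;
    rewrite addrC addKr.
move=> [u v] [/= Bu Bv]; have := BA _ _ Bu Bv.
by rewrite /= addrACA [x + _]addrC [y + _]addrC !subrK.
Qed.

End FilteredGroup.

(** Every map into the resulting group is continuous, which frees the universal property of AP(X)
    from its continuity assumption. *)
Lemma indiscrete_group_filter (G : zmodType) : group_filter [set @setT G].
Proof.
split=> [|A -> //|A ->]; last by exists setT.
split=> //= [P Q -> ->|P Q PQ PT]; first by rewrite setIT.
by apply/seteqP; split=> // x _; apply: PQ; rewrite PT.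
Qed.

(** * Homomorphisms out of AP(X) *)

Section MarkovFree.
Variables (X : topologicalType) (A : PreTopologicalZmodule.type) (i : X -> A).
Hypothesis freeA : markov_free_abelian i.

Lemma markov_free_hom_unique (G : zmodType) (f g : {additive A -> G}) :
  (forall x, f (i x) = g (i x)) -> f =1 g.
Proof.
move=> fg a; pose S : {pred A} := [pred a | f a == g a].
suff /eqP : a \in S by [].
apply: (markov_free_generates freeA) => [|x]; last by rewrite inE fg.
split=> [|x y]; rewrite !inE ?raddf0 // => /eqP fgx /eqP fgy.
by rewrite !raddfB fgx fgy.
Qed.

Lemma markov_free_hom (G : zmodType) (f : X -> G) :
  exists g : {additive A -> G}, forall x, g (i x) = f x.
Proof.
pose H : PreTopologicalZmodule.type := filtered_group (indiscrete_group_filter G).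
have cf : continuous (f : X -> H).
  move=> x B xB; rewrite /nbhs /=.
  suff -> : B = setT by exact: filterT.
  apply/seteqP; split=> // y _.
  move: xB; rewrite /nbhs /= /filtered_group_nbhs /= => BT.
  have : [set h | B (f x + h)] (y - f x) by rewrite BT.
  by rewrite /= addrC subrK.
have [g _ gf] := markov_free_extension freeA
  (@filtered_group_paratopological _ _ (indiscrete_group_filter G)) cf.
by exists g.
Qed.

End MarkovFree.

(** * Sums with dyadic weights *)

Section DyadicSum.
Variables (G : zmodType) (V : nat -> set G).
Hypothesis V0 : forall n, V n 0.
Hypothesis VD : forall n a b, V n.+1 a -> V n.+1 b -> V n (a + b).

(* [dyadic_sum K w a] says that a is a sum of elements of V_(n_1), ..., V_(n_k)
   with all n_j <= K and w / 2 ^ K = 1 / 2 ^ n_1 + ... + 1 / 2 ^ n_k. *)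
Inductive dyadic_sum (K : nat) : nat -> G -> Prop :=
| dyadic_sum0 : dyadic_sum K 0 0
| dyadic_sumS n a w b : (n <= K)%N -> V n a -> dyadic_sum K w b ->
    dyadic_sum K (2 ^ (K - n) + w) (a + b).

Lemma dyadic_sum1 n a : V n a -> dyadic_sum n 1 a.
Proof.
move=> Va; have := dyadic_sumS (leqnn n) Va (dyadic_sum0 n).
by rewrite subnn addr0.
Qed.

Lemma dyadic_sumD K w w' a b :
  dyadic_sum K w a -> dyadic_sum K w' b -> dyadic_sum K (w + w') (a + b).
Proof.
move=> + sb; elim=> [|n c v e nK Vc _ IH]; first by rewrite add0r.
by rewrite -addrA -addnA; exact: dyadic_sumS.
Qed.

Lemma dyadic_sum_lift K m w a :
  dyadic_sum K w a -> dyadic_sum (K + m) (w * 2 ^ m) a.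
Proof.
elim=> [|n c v e nK Vc _ IH]; first exact: dyadic_sum0.
rewrite mulnDl -expnD addnBAC //; apply: dyadic_sumS => //.
exact: leq_trans (leq_addr _ _).
Qed.

Lemma dyadic_sum_weight0 K w a : dyadic_sum K w a -> w = 0%N -> a = 0.
Proof.
by case=> // n c v e _ _ _ /eqP; rewrite addn_eq0 expn_eq0.
Qed.

(** Only terms from [V K.+1] have odd weight. Two of them add up to an element of [V K], so at most
    one is left over, exactly when [w] is odd. *)
Lemma dyadic_sum_carry K w a : dyadic_sum K.+1 w a ->
  (exists2 v, w = v.*2 & dyadic_sum K v a) \/
  exists v b c, [/\ w = v.*2.+1, a = b + c, V K.+1 b & dyadic_sum K v c].
Proof.
elim=> [|n c v e + Vc _ IH].
  by left; exists 0%N => //; exact: dyadic_sum0.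
rewrite leq_eqVlt => /predU1P[nK|nK].
  rewrite {}nK {n} subnn expn0 in Vc *.
  case: IH => [[u -> su]|[u [b [h [-> -> Vb sh]]]]].
    by right; exists u, c, e; rewrite add1n.
  left; exists u.+1 => //.
  have := dyadic_sumS (leqnn K) (VD Vc Vb) sh.
  by rewrite subnn addrA.
have E : (2 ^ (K.+1 - n) = (2 ^ (K - n)).*2)%N.
  by rewrite subSn // expnS mul2n.
case: IH => [[u -> su]|[u [b [h [-> -> Vb sh]]]]].
  left; exists (2 ^ (K - n) + u)%N; first by rewrite doubleD E.
  exact: dyadic_sumS.
right; exists (2 ^ (K - n) + u)%N, b, (c + h).
by split=> //; [rewrite doubleD E addnS|rewrite addrCA|exact: dyadic_sumS].
Qed.

(** Each carry lowers the precision by one. At precision [n], a weight of at most 1 leaves at most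
    one term, which must come from [V n]. *)
Lemma dyadic_sum_sub K n w a :
  dyadic_sum (n + K) w a -> (w <= 2 ^ K)%N -> V n a.
Proof.
elim: K w a => [|K IH] w a.
  rewrite addn0; case=> [|m b v e mn Vb se]; first by move=> _; exact: V0.
  have p0 : (0 < 2 ^ (n - m))%N by rewrite expn_gt0.
  rewrite expn0 => le1.
  have v0 : v = 0%N by lia.
  rewrite (dyadic_sum_weight0 se v0) addr0.
  have /eqP : (2 ^ (n - m) = 2 ^ 0)%N by rewrite expn0; lia.
  rewrite eqn_exp2l // subn_eq0 => nm.
  by have <- : m = n by apply/eqP; rewrite eqn_leq mn.
rewrite addnS expnS mul2n => /dyadic_sum_carry[[v ->]|[v [b [c [-> -> Vb sc]]]]].
  by rewrite leq_double; exact: IH.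
(* The leftover [b] is moved to [V (n + K)], which rounds the weight up to [v.+1]; the bound
   survives because [2 ^ K.+1] is even. *)
rewrite -ltnS -doubleS => le1; apply: (IH v.+1).
  have Vb' : V (n + K) b by rewrite -[b]addr0; exact: VD.
  by have := dyadic_sumS (leqnn _) Vb' sc; rewrite subnn.
by lia.
Qed.

End DyadicSum.

(** * Subadditive functions as infima of dyadic weights *)

Section InfSubadditive.
Variable R : realType.

Lemma nonneg_has_inf (E : set R) :
  E !=set0 -> (forall x, E x -> 0 <= x) -> has_inf E.
Proof. by move=> E0 En; split=> //; exists 0. Qed.

Lemma inf_le_add (E F D : set R) :
  E !=set0 -> F !=set0 ->
  (forall x, E x -> 0 <= x) -> (forall x, F x -> 0 <= x) ->
  (forall x, D x -> 0 <= x) ->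
  (forall x y, E x -> F y -> exists2 z, D z & z <= x + y) ->
  inf D <= inf E + inf F.
Proof.
move=> E0 F0 En Fn Dn EFD; apply/ler_addgt0Pr => e e0.
have e20 : 0 < e / 2 by rewrite divr_gt0.
have [x Ex xE] := inf_adherent e20 (nonneg_has_inf E0 En).
have [y Fy yF] := inf_adherent e20 (nonneg_has_inf F0 Fn).
have [z Dz zxy] := EFD _ _ Ex Fy.
have zD : inf D <= z by apply: ge_inf => //; exists 0.
lra.
Qed.

Lemma nonneg_inf_ge0 (E : set R) : (forall x, E x -> 0 <= x) -> 0 <= inf E.
Proof.
move=> En; have [->|/set0P E0] := eqVneq E set0; first by rewrite inf0.
exact: lb_le_inf.
Qed.

End InfSubadditive.

(** The Birkhoff-Kakutani construction without symmetry: [nu a] is the infimum of the weights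
    [w / 2 ^ K] of the dyadic sums equal to [a]. Such sums exist because [V 0] is everything. *)
Lemma dyadic_norm (R : realType) (G : zmodType) (V : nat -> set G) :
  (forall n, V n 0) -> (forall n a b, V n.+1 a -> V n.+1 b -> V n (a + b)) ->
  V 0%N = setT ->
  exists nu : G -> R,
    [/\ forall a, 0 <= nu a, nu 0 = 0, forall a b, nu (a + b) <= nu a + nu b,
      forall n a, V n a -> nu a <= 2 ^- n & forall n a, nu a < 2 ^- n -> V n a].
Proof.
move=> V0 VD VT.
pose E a : set R :=
  [set r | exists K w, dyadic_sum V K w a /\ r = w%:R / 2 ^+ K].
have p2 n : 0 < 2 ^+ n :> R by rewrite exprn_gt0.
have Ep a r : E a r -> 0 <= r.
  by move=> [K [w [_ ->]]]; rewrite divr_ge0 ?ler0n// ltW.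
have EV n a : V n a -> E a (2 ^- n).
  by move=> Va; exists n, 1%N; split; [exact: dyadic_sum1|rewrite mul1r].
have E0 a : E a !=set0 by exists (2 ^- 0); apply: EV; rewrite VT.
have lbE a : has_lbound (E a) by exists 0; exact: Ep.
exists (fun a => inf (E a)); split.
- by move=> a; apply: nonneg_inf_ge0; exact: Ep.
- apply/eqP; rewrite eq_le nonneg_inf_ge0 ?andbT; last exact: Ep.
  apply: ge_inf => //; exists 0%N, 0%N; split; first exact: dyadic_sum0.
  by rewrite mul0r.
- move=> a b; apply: inf_le_add; do ?[exact: Ep|exact: E0].
  move=> _ _ [K [w [sa ->]]] [L [v [sb ->]]].
  exists ((w * 2 ^ L + v * 2 ^ K)%:R / 2 ^+ (K + L)).
    exists (K + L)%N, (w * 2 ^ L + v * 2 ^ K)%N; split=> //.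
    by apply: dyadic_sumD; [|rewrite addnC]; exact: dyadic_sum_lift.
  rewrite natrD !natrM !natrX exprD le_eqVlt; apply/orP; left; apply/eqP.
  by field; rewrite !gt_eqF.
- by move=> n a /EV; exact: ge_inf.
- move=> n a.
  move=> /(inf_lt (E0 a))[_ [K [w [sa ->]]]].
  (* Clearing denominators gives [w * 2 ^ n < 2 ^ K], the bound needed by [dyadic_sum_sub] at
     precision [n + K]. *)
  rewrite ltr_pdivrMr// mulrC ltr_pdivlMr// -!natrX -natrM ltr_nat => lt.
  apply: (@dyadic_sum_sub _ V V0 VD K n (w * 2 ^ n)); last exact: ltnW.
  by rewrite addnC; exact: dyadic_sum_lift.
Qed.

Lemma exp2V_lt (R : realType) (r : R) : 0 < r -> exists n : nat, 2 ^- n < r.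
Proof.
move=> r0; have [n _ nr] := near_infty_natSinv_expn_lt (PosNum r0).
by exists n; have := nr n (leqnn n); rewrite div1r.
Qed.

(** For the least [n] with [2 ^- n <= t], [t] is at most [2 * 2 ^- n]. One factor 2 is lost here,
    the other in the index shift of the hypothesis. *)
Lemma dyadic_le (R : realType) (s t : R) : 0 <= s -> t <= 1 ->
  (forall n, s < 2 ^- n.+1 -> t < 2 ^- n) -> t <= 4 * s.
Proof.
move=> s0 t1 st; have [/le_trans->//|t0] := leP t 0; first by rewrite mulr_ge0.
have /ex_minnP[n nt nmin] : exists n : nat, 2 ^- n <= t.
  by have [n /ltW] := exp2V_lt t0; exists n.
rewrite leNgt; apply/negP => st4.
suff tn : t <= 2 * 2 ^- n.
  have sn : s < 2 ^- n.+1 by rewrite exprS invfM; lra.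
  by have := st n sn; rewrite ltNge nt.
case: n nt nmin => [|n] nt nmin; first by rewrite invr1; lra.
rewrite exprS invfM mulrA divff ?pnatr_eq0// mul1r leNgt.
by apply/negP => /ltW /nmin; rewrite ltnn.
Qed.

(** * Neighborhoods of 0 in paratopological groups *)

Section ParatopologicalGroup.
Variable G : PreTopologicalZmodule.type.
Hypothesis paraG : paratopological_group G.

Lemma paratopological_translation (a : G) : continuous (fun x : G => a + x).
Proof.
move=> x A /(paraG (x := (a, x)))[[B C] /= [Ba Cx] BC].
apply: filterS Cx => y Cy; apply: (BC (a, y)); split=> //=.
exact: nbhs_singleton Ba.
Qed.

Lemma paratopological_nbhs (a : G) (A : set G) :
  nbhs a A -> nbhs 0 [set x | A (a + x)].
Proof.
by move=> aA; apply: paratopological_translation; rewrite /= addr0.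
Qed.

Lemma paratopological_nbhs0 (a : G) (A : set G) :
  nbhs 0 A -> nbhs a [set x | A (x - a)].
Proof.
move=> A0; have : nbhs a ((fun x => - a + x) @^-1` A).
  by apply: paratopological_translation; rewrite /= addNr.
by apply: filterS => x; rewrite /= addrC.
Qed.

Lemma paratopological_split (A : set G) : nbhs 0 A ->
  exists2 B, nbhs 0 B & forall a b, B a -> B b -> A (a + b).
Proof.
move=> A0; have : nbhs ((0 : G) + 0) A by rewrite addr0.
move=> /(paraG (x := (0, 0)))[[B C] /= [B0 C0] BC].
exists (B `&` C); first exact: filterI.
by move=> a b [Ba _] [_ Cb]; exact: (BC (a, b)).
Qed.

Lemma paratopological_norm (R : realType) (N : nat -> set G) :
  (forall n, nbhs 0 (N n)) ->
  exists nu : G -> R,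
    [/\ forall a, 0 <= nu a <= 1, nu 0 = 0, forall a b, nu (a + b) <= nu a + nu b,
      forall r, 0 < r -> nbhs 0 [set a | nu a < r] &
      forall n a, nu a < 2 ^- n.+1 -> N n a].
Proof.
move=> N0.
(* A dummy value is returned when [A] is not a neighborhood of 0, so that [half] is total and can be
   iterated. *)
have half (A : set G) : {B | nbhs 0 A -> nbhs 0 B /\
    forall a b, B a -> B b -> A (a + b)}.
  apply: cid; have [A0|nA0] := pselect (nbhs 0 A); last by exists A.
  by have [B B0 BA] := paratopological_split A0; exists B.
(* [dyadic_norm] wants [V 0] to be everything, so [N n] enters only at index [n.+1]; hence the
   exponent [n.+1] in the conclusion. *)
pose V := fix V n := if n is m.+1 then projT1 (half (V m)) `&` N m else setT.
have V0 n : nbhs 0 (V n).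
  elim: n => [|n IH] /=; first exact: filterT.
  by apply: filterI => //; have [] := projT2 (half (V n)) IH.
have VD n a b : V n.+1 a -> V n.+1 b -> V n (a + b).
  move=> /= [Ba _] [Bb _]; have [_] := projT2 (half (V n)) (V0 n).
  exact.
have VV n : V n 0 by exact: nbhs_singleton.
have [nu [nu_ge0 nu0 nuD nuV Vnu]] := dyadic_norm R VV VD erefl.
exists nu; split=> //.
- by move=> a; rewrite nu_ge0 /= (le_trans (nuV 0%N a I))// invr1.
- move=> r r0; have [n nr] := exp2V_lt r0.
  by apply: filterS (V0 n) => a /nuV /le_lt_trans; apply.
- by move=> n a /Vnu[].
Qed.

Lemma norm_quasi_pseudometric (R : realType) (T : Type) (i : T -> G)
  (nu : G -> R) :
  (forall a, 0 <= nu a) -> nu 0 = 0 -> (forall a b, nu (a + b) <= nu a + nu b) ->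
  quasi_pseudometric (fun x y => nu (i y - i x)).
Proof.
move=> nu_ge0 nu0 nuD; split=> [x y|x|x y z] //; first by rewrite subrr.
by rewrite [leRHS]addrC; apply: le_trans (nuD _ _); rewrite addrA subrK.
Qed.

Lemma norm_ball_nbhs (R : realType) (T : topologicalType) (i : T -> G)
  (nu : G -> R) : continuous i ->
  (forall r, 0 < r -> nbhs 0 [set a | nu a < r]) ->
  forall x r, 0 < r -> nbhs x [set y | nu (i y - i x) < r].
Proof.
by move=> ci nun x r r0; exact: ci (paratopological_nbhs0 (i x) (nun r r0)).
Qed.

End ParatopologicalGroup.

(** * Continuity of quasi-pseudometrics through balls *)

Section UniversalQuasiUniformity.
Variables (R : realType) (T : topologicalType) (d : T -> T -> R).
Hypothesis qd : quasi_pseudometric d.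

(** Adjoining the sets [d < s] to the universal quasi-uniformity does not change its topology, since
    balls are neighborhoods; being finest, it already contains them. *)
Lemma universal_quasi_uniformity_ball (r : R) :
  (forall x (r : R), 0 < r -> nbhs x [set y | d x y < r]) -> 0 < r ->
  @universal_quasi_uniformity T [set p | d p.1 p.2 < r].
Proof.
move=> dn r0.
have [[FU Udiag Usplit] Unbhs] := universal_quasi_uniformity_compatible T.
pose U : set_system (T * T) := [set A | exists B s,
  [/\ universal_quasi_uniformity B, 0 < s &
      B `&` [set p | d p.1 p.2 < s] `<=` A]].
have cU : compatible_quasi_uniformity U.
  split=> [|x].
    split.
    - split.
      + by exists setT, 1; split=> //; exact: filterT.
      + move=> P Q [B [s [UB s0 BP]]] [C [t [UC t0 CQ]]].
        exists (B `&` C), (Num.min s t); split; first exact: filterI.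
          by rewrite lt_min s0.
        move=> p [[Bp Cp]] /=; rewrite lt_min => /andP[ds dt].
        by split; [exact: BP|exact: CQ].
      + move=> P Q PQ [B [s [UB s0 BP]]]; exists B, s; split=> //.
        exact: subset_trans PQ.
    - move=> A [B [s [UB s0 BA]]] [x y] xy; apply: BA; split.
        exact: Udiag xy.
      have -> : x = y by exact: xy.
      by rewrite /= (quasi_pseudometric_refl qd).
    - move=> A [B [s [UB s0 BA]]]; have [C UC CB] := Usplit _ UB.
      exists (C `&` [set p | d p.1 p.2 < s / 2]).
        by exists C, (s / 2); split=> //; rewrite divr_gt0.
      move=> [x y] [z [/= Cxz dxz] [/= Czy dzy]]; apply: BA; split.
        by apply: CB; exists z.
      by have /= := quasi_pseudometric_triangle qd x y z; lra.
  apply/seteqP; split=> A.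
    case=> P [B [s [UB s0 BP]]] PA.
    apply: (@filterS _ _ _ (xsection B x `&` [set y | d x y < s])).
      move=> y [/xsectionP Bxy dxy]; apply/PA/xsectionP.
      by apply: BP; split.
    have Bx : nbhs x (xsection B x) by rewrite -Unbhs; exists B.
    by apply: (filterI Bx); exact: dn.
  rewrite -Unbhs => -[B UB BA]; exists B => //; exists B, 1.
  by split=> // p [].
apply: (universal_quasi_uniformity_finest cU).
by exists setT, r; split=> [||p []] //; exact: filterT.
Qed.

(** For the balls, apply continuity at [(x, x)] and keep the first coordinate at [x]. Conversely,
    [d x' y'] is at most [d x' x + d x y + d y y'], and the inverse quasi-uniformity makes [d x' x]
    small. *)
Lemma qu_continuousP :
  qu_continuous d <-> forall x (r : R), 0 < r -> nbhs x [set y | d x y < r].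
Proof.
split=> [cd x r r0|dn UT x y B].
  have [_ Unbhs] := universal_quasi_uniformity_compatible T.
  have [] := cd x x [set t | t < r].
    exists [set p | p.2 < p.1 + r]; first by exists r.
    by move=> t /xsectionP /=; rewrite (quasi_pseudometric_refl qd) add0r.
  move=> [B C] /= [[_ [B' UB' <-] B'B]].
  rewrite Unbhs => Cx BC; apply: filterS Cx => y Cy.
  apply: (BC (x, y)); split=> //=; apply/B'B/xsectionP.
  have [[_ Udiag _] _] := universal_quasi_uniformity_compatible T.
  exact: Udiag UB' (x, x) erefl.
move=> [P [r /= r0 rP] PA].
have r20 : 0 < r / 2 by rewrite divr_gt0.
have Ud := universal_quasi_uniformity_ball dn r20.
exists ([set x' | d x' x < r / 2], [set y' | d y y' < r / 2]).
  split=> /=.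
    exists ([set p | d p.1 p.2 < r / 2]^-1)%relation; last first.
      by move=> x' /xsectionP.
    by exists [set p | d p.1 p.2 < r / 2].
  by exists [set p | d p.1 p.2 < r / 2] => // y' /xsectionP.
move=> [x' y'] [/= dx dy]; apply/PA/xsectionP/rP => /=.
have := quasi_pseudometric_triangle qd x' y' x.
have := quasi_pseudometric_triangle qd x y' y.
lra.
Qed.

End UniversalQuasiUniformity.

(** * Graev-type neighborhoods of 0 in AP(X) *)

Section Graev.
Variables (R : realType) (T : topologicalType) (A : PreTopologicalZmodule.type).
Variables (i : T -> A) (d : T -> T -> R).

(** Arbitrary lists are allowed, not only reduced words, so that concatenation adds both the
    elements and their costs. *)
Definition graev_ball (r : R) : set A :=
  [set a | exists2 L : seq (T * T),
     a = \sum_(p <- L) (i p.2 - i p.1) & \sum_(p <- L) d p.1 p.2 < r].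

Hypothesis freeA : markov_free_abelian i.
Hypothesis qd : quasi_pseudometric d.

Lemma graev_group_filter :
  group_filter (filter_from [set r : R | 0 < r] graev_ball).
Proof.
split.
- apply: filter_from_filter; first by exists 1 => /=.
  move=> r s /= r0 s0; exists (Num.min r s); first by rewrite lt_min r0.
  by move=> a [L -> ]; rewrite lt_min => /andP[Lr Ls]; split; exists L.
- by move=> B [r r0]; apply; exists [::]; rewrite !big_nil.
- move=> B [r /= r0 rB]; exists (graev_ball (r / 2)).
    by exists (r / 2) => //=; rewrite divr_gt0.
  move=> a b [L -> Lr] [M -> Mr]; apply: rB.
  by exists (L ++ M); rewrite !big_cat //=; lra.
Qed.

(** The balls define a group topology in which [i] is continuous. The continuous extension of [i] is
    the identity, so the topology of AP(X) is finer. *)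
Lemma graev_ball_nbhs (r : R) :
  (forall x (r : R), 0 < r -> nbhs x [set y | d x y < r]) -> 0 < r ->
  nbhs 0 (graev_ball r).
Proof.
move=> dn r0.
pose H : PreTopologicalZmodule.type := filtered_group graev_group_filter.
have ci : continuous (i : T -> H).
  move=> x B [s s0 sB]; apply: filterS (dn x s s0) => y dxy.
  have := sB (i y - i x); rewrite /= [i x + _]addrC subrK; apply.
  by exists [:: (x, y)]; rewrite !big_seq1.
have [g cg gi] := markov_free_extension freeA
  (@filtered_group_paratopological _ _ graev_group_filter) ci.
have gid : g =1 idfun :=
  markov_free_hom_unique freeA (f := g) (g := idfun : {additive A -> A}) gi.
have Hr : nbhs (g 0 : H) (graev_ball r).
  by rewrite raddf0; exists r => // a; rewrite /= add0r.
have : nbhs 0 (g @^-1` graev_ball r) := cg 0 _ Hr.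
by apply: filterS => a /=; rewrite gid.
Qed.

(** The homomorphism extending [d x] takes the value [d x y] on [i y - i x], and at most [d p.1 p.2]
    on the difference of a pair [p]. *)
Lemma graev_ball_dist (r : R) (x y : T) :
  graev_ball r (i y - i x) -> d x y < r.
Proof.
move=> [L Exy]; apply: le_lt_trans.
have [F Fi] := markov_free_hom freeA (d x : T -> R : zmodType).
have := congr1 F Exy.
rewrite raddfB raddf_sum /= !Fi (quasi_pseudometric_refl qd) subr0 => ->.
apply: ler_sum => p _; rewrite raddfB !Fi lerBlDl.
exact: quasi_pseudometric_triangle.
Qed.

End Graev.

(** * AP(X) as a subgroup of AP(Y) *)

Section Subspace.
Variables (R : realType) (Y : topologicalType) (X : set Y).
Variables (APX APY : PreTopologicalZmodule.type) (iX : X -> APX) (iY : Y -> APY).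
Variable e : {additive APX -> APY}.
Hypothesis freeX : markov_free_abelian iX.
Hypothesis freeY : markov_free_abelian iY.
Hypothesis eE : forall x : X, e (iX x) = iY (\val x).

(** Sending the points outside [X] to 0 extends to a left inverse of [e]. *)
Lemma markov_free_subspace_injective : injective e.
Proof.
pose f (y : Y) : APX := if insub y is Some x then iX x else 0.
have [g gi] := markov_free_hom freeY (f : Y -> APX : zmodType).
have ge : (g \o e : {additive APX -> APX}) =1 idfun.
  apply: (markov_free_hom_unique freeX (g := idfun)) => x /=.
  by rewrite eE gi /f valK.
by apply: (can_inj (g := g)) => a; exact: ge.
Qed.

(** The coordinate at [z] is a homomorphism on AP(Y) that vanishes on the image of [e]. *)
Lemma balanced_outside_subspace (L : seq (Y * Y)) (a : APX) (z : Y) :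
  e a = \sum_(p <- L) (iY p.2 - iY p.1) -> z \notin X ->
  count (fun p => p.1 == z) L = count (fun p => p.2 == z) L.
Proof.
move=> eaL zX.
have [c ci] := markov_free_hom freeY (fun y : Y => (y == z)%:Z).
have ce0 : (c \o e : {additive APX -> int}) =1 \0%R.
  apply: (markov_free_hom_unique freeX) => x /=.
  rewrite eE ci; case: eqP => // xz.
  by rewrite -xz (valP x) in zX.
have := ce0 a; rewrite /= {}eaL raddf_sum /=.
have -> : \sum_(p <- L) c (iY p.2 - iY p.1) =
    (count (fun p => p.2 == z) L)%:Z - (count (fun p => p.1 == z) L)%:Z.
  elim: L => [|p L IH]; first by rewrite big_nil subrr.
  by rewrite big_cons IH /= raddfB !ci !PoszD; lia.
by move=> /eqP; rewrite subr_eq0 => /eqP[->].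
Qed.

Variables (nu : APX -> R) (dY : Y -> Y -> R).
Hypothesis nu0 : nu 0 = 0.
Hypothesis nuD : forall a b, nu (a + b) <= nu a + nu b.
Hypothesis qdY : quasi_pseudometric dY.
Hypothesis dYE : forall x y : X, dY (\val x) (\val y) = nu (iX y - iX x).

(* A point outside X that occurs as an endpoint of some pair occurs equally
   often as a left and as a right endpoint, so two pairs (x, z), (z, y) can be
   merged into (x, y) at no cost, by the triangle inequality. *)
Lemma norm_le_graev_length (L : seq (Y * Y)) (a : APX) :
  e a = \sum_(p <- L) (iY p.2 - iY p.1) ->
  nu a <= \sum_(p <- L) dY p.1 p.2.
Proof.
have [n] := ubnP (size L); elim: n L => // n IH L /ltnSE szL eaL.
have [/hasP[p pL pX]|/hasPn LX2] := boolP (has (fun p => p.2 \notin X) L).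
  have perm_pL := perm_to_rem pL; set M := rem p L in perm_pL.
  have szM : size L = (size M).+1 by rewrite (perm_size perm_pL).
  (* A pair of equal points contributes nothing and is dropped; otherwise balance provides another
     pair starting at [p.2]. *)
  have [pp|pp] := eqVneq p.1 p.2.
    rewrite (perm_big _ perm_pL) big_cons /= pp (quasi_pseudometric_refl qdY).
    rewrite add0r; apply: IH; first by rewrite -szM.
    by rewrite eaL (perm_big _ perm_pL) big_cons /= pp subrr add0r.
  have : has (fun q => q.1 == p.2) M.
    have := balanced_outside_subspace eaL pX.
    rewrite !(permP perm_pL) /= (negbTE pp) eqxx add0n has_count => ->.
    by [].
  case/hasP => q qM /eqP qp.
  have perm_qM := perm_to_rem qM; set N := rem q M in perm_qM.
  have szN : size M = (size N).+1 by rewrite (perm_size perm_qM).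
  have perm_L : perm_eq L (p :: q :: N).
    by rewrite (perm_trans perm_pL)// perm_cons.
  apply: (@le_trans _ _ (\sum_(t <- (p.1, q.2) :: N) dY t.1 t.2)).
    apply: IH; first by rewrite /= -szN -szM.
    rewrite eaL (perm_big _ perm_L) !big_cons /= qp addrA; congr (_ + _).
    by rewrite addrC addrA subrK.
  rewrite (perm_big _ perm_L) !big_cons /= addrA lerD2r qp.
  exact: quasi_pseudometric_triangle.
(* With no right endpoint outside [X], balance excludes left ones too. *)
have LX1 p : p \in L -> p.1 \in X.
  move=> pL; apply/negPn/negP => pX.
  have := balanced_outside_subspace eaL pX; apply/eqP.
  rewrite gtn_eqF// (_ : count _ _ = 0%N).
    by rewrite -has_count; apply/hasP; exists p.
  apply/eqP; rewrite eqn0Ngt -has_count; apply/hasPn => q qL.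
  by apply: contra pX => /eqP <-; have := LX2 _ qL; rewrite negbK.
(* All pairs now lie in [X], so the sum lifts to AP(X); by injectivity the lift is [a]. *)
have : exists2 b, e b = \sum_(p <- L) (iY p.2 - iY p.1) &
    nu b <= \sum_(p <- L) dY p.1 p.2.
  elim: L {IH szL eaL} LX1 LX2 => [|p L IHL] LX1 LX2.
    by exists 0; rewrite !big_nil ?raddf0 ?nu0.
  have [b eb nub] : exists2 b, e b = \sum_(p <- L) (iY p.2 - iY p.1) &
      nu b <= \sum_(p <- L) dY p.1 p.2.
    apply: IHL => q qL; [apply: LX1|apply: LX2];
    by rewrite in_cons qL orbT.
  have X1 : p.1 \in X by apply: LX1; rewrite mem_head.
  have X2 : p.2 \in X by rewrite -[_ \in _]negbK; apply: LX2; rewrite mem_head.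
  pose x1 : X := exist _ p.1 X1; pose x2 : X := exist _ p.2 X2.
  exists (iX x2 - iX x1 + b).
    by rewrite raddfD raddfB !eE eb big_cons.
  rewrite big_cons; apply: le_trans (nuD _ _) _.
  by rewrite lerD// -dYE.
case=> b; rewrite -eaL => /markov_free_subspace_injective ->.
exact.
Qed.

End Subspace.

(** * Extension of a dominated quasi-pseudometric *)

Lemma quasi_pseudometric_extension (R : realType) (S T : Type) (f : S -> T)
    (d : S -> S -> R) (rho : T -> T -> R) :
  quasi_pseudometric d -> quasi_pseudometric rho ->
  (forall x y, d x y <= rho (f x) (f y)) ->
  exists dT : T -> T -> R, [/\ quasi_pseudometric dT,
    forall x y, dT x y <= rho x y & forall x y, dT (f x) (f y) = d x y].
Proof.
move=> [d_ge0 dxx dD] [rho_ge0 rhoxx rhoD] drho.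
pose E x y : set R := [set rho x y] `|`
  [set r | exists a b, r = rho x (f a) + d a b + rho (f b) y].
have En x y r : E x y r -> 0 <= r.
  by move=> [->//|[a [b ->]]]; rewrite !addr_ge0.
have lbE x y : has_lbound (E x y) by exists 0; exact: En.
have E0 x y : E x y !=set0 by exists (rho x y); left.
have le_rho x y : inf (E x y) <= rho x y by apply: ge_inf => //; left.
exists (fun x y => inf (E x y)); split=> //.
- split=> [x y|x|x y z].
  + by apply: nonneg_inf_ge0; exact: En.
  + apply/eqP; rewrite eq_le -{1}(rhoxx x) le_rho.
    by apply: nonneg_inf_ge0; exact: En.
  + apply: inf_le_add; do ?[exact: En|exact: E0].
    move=> _ _ [->|[a [b ->]]] [->|[a' [b' ->]]].
    * by exists (rho x y); [left|exact: rhoD].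
    * exists (rho x (f a') + d a' b' + rho (f b') y).
        by right; exists a', b'.
      by have := rhoD x (f a') z; lra.
    * exists (rho x (f a) + d a b + rho (f b) y).
        by right; exists a, b.
      by have := rhoD (f b) y z; lra.
    (* Two passages through [S] merge into one, since the stretch between them costs at least
       [d b a']. *)
    * exists (rho x (f a) + d a b' + rho (f b') y).
        by right; exists a, b'.
      have := rhoD (f b) (f a') z; have := drho b a'.
      have := dD a b' b; have := dD b b' a'; lra.
- move=> x y; apply/eqP; rewrite eq_le; apply/andP; split.
    apply: ge_inf => //; right; exists x, y.
    by rewrite !rhoxx add0r addr0.
  apply: lb_le_inf => // _ [->|[a [b ->]]]; first exact: drho.
  have := drho x a; have := drho b y; have := dD x y a; have := dD a y b.
  lra.
Qed.

Lemma topological_embedding_continuous (S T : topologicalType) (f : S -> T) :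
  topological_embedding f -> continuous f.
Proof. by move=> [_ fE]; apply/continuousP => B oB; rewrite fE; exists B. Qed.

(** * The two implications *)

Section Embedding.
Variables (R : realType) (Y : topologicalType) (X : set Y).
Variables (APX APY : PreTopologicalZmodule.type) (iX : X -> APX) (iY : Y -> APY).
Variable e : {additive APX -> APY}.
Hypothesis freeX : markov_free_abelian iX.
Hypothesis freeY : markov_free_abelian iY.
Hypothesis eE : forall x : X, e (iX x) = iY (\val x).

Let paraX : paratopological_group APX.
Proof. exact: markov_free_paratopological freeX. Qed.

Let paraY : paratopological_group APY.
Proof. exact: markov_free_paratopological freeY. Qed.

Let ciX : continuous iX.
Proof. exact: topological_embedding_continuous (markov_free_embedding freeX). Qed.

Let ciY : continuous iY.
Proof. exact: topological_embedding_continuous (markov_free_embedding freeY). Qed.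

Lemma quasi_Pstar_embedded_nbhs0 (N : set APX) :
  quasi_Pstar_embedded R X -> nbhs 0 N ->
  exists2 W, nbhs 0 W & e @^-1` W `<=` N.
Proof.
move=> qPX N0.
(* A constant sequence suffices: only level 0, with threshold 1/2, is used. *)
have [nu [nu01 nu0 nuD nun nuN]] :=
  paratopological_norm paraX R (fun=> N0).
have nu_ge0 a : 0 <= nu a by case/andP: (nu01 a).
have qd := norm_quasi_pseudometric iX nu_ge0 nu0 nuD.
have [] := qPX _ qd.
- by exists 1 => x y; case/andP: (nu01 (iX y - iX x)).
- by apply/(qu_continuousP qd); exact: norm_ball_nbhs.
move=> dY [qdY /(qu_continuousP qdY) dYn dYE].
exists (graev_ball iY dY (2 ^- 1)).
  by apply: graev_ball_nbhs => //; rewrite invr_gt0 exprn_gt0.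
move=> a [L eaL Llt]; apply: (nuN 0%N); apply: le_lt_trans Llt.
exact: (norm_le_graev_length freeX freeY eE nu0 nuD qdY dYE eaL).
Qed.

Lemma quasi_Pstar_embedded_topological_monomorphism :
  continuous e -> quasi_Pstar_embedded R X -> topological_monomorphism e.
Proof.
move=> ce qPX; split; first exact: (markov_free_subspace_injective freeX freeY eE).
apply/seteqP; split=> [U oU|_ [B oB <-]]; last by move/continuousP: ce; exact.
(* The union of [D] is the largest open set whose preimage lies in [U]; translates of [W] show that
   it covers the image of [U]. *)
pose D : set (set APY) := [set B | open B /\ e @^-1` B `<=` U].
exists (\bigcup_(B in D) B); first by apply: bigcup_open => B; case.
apply/seteqP; split=> a; first by move=> [B [_ BU] Ba]; exact: BU.
move=> Ua; have aU : nbhs a U by exact: open_nbhs_nbhs.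
have [W W0 WU] :=
  quasi_Pstar_embedded_nbhs0 qPX (paratopological_nbhs paraX aU).
have Wea := paratopological_nbhs0 paraY (e a) W0.
exists (interior [set b | W (b - e a)]) => //; split.
  exact: open_interior.
move=> b /interior_subset /=; rewrite -raddfB => /WU /=.
by rewrite addrC subrK.
Qed.

Lemma topological_monomorphism_quasi_Pstar_embedded :
  topological_monomorphism e -> quasi_Pstar_embedded R X.
Proof.
move=> [_ eopen] d qd [M dM] /(qu_continuousP qd) dn.
(* A positive bound, so that [d / C] is at most 1 as [dyadic_le] requires. *)
pose C := Num.max M 1.
have C0 : 0 < C by rewrite lt_max ltr01 orbT.
have dC x y : d x y <= C by rewrite le_max dM.
have /choice[N NP] n : exists N : set APY,
    nbhs 0 N /\ e @^-1` N `<=` graev_ball iX d (C * 2 ^- n).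
  have r0 : 0 < C * 2 ^- n by rewrite mulr_gt0// invr_gt0 exprn_gt0.
  have := graev_ball_nbhs freeX dn r0.
  rewrite nbhsE => -[U [oU U0] UB]; move: oU; rewrite eopen => -[B oB BU].
  exists B; split; last by rewrite BU.
  by apply: open_nbhs_nbhs; split=> //; rewrite -(raddf0 e) -BU in U0 *.
have [nu [nu01 nu0 nuD nun nuN]] :=
  paratopological_norm paraY R (fun n => (NP n).1).
have nu_ge0 a : 0 <= nu a by case/andP: (nu01 a).
(* The 4 is the constant of [dyadic_le], applied below to [nu] and [d / C]; this yields [d <= mu] on
   [X]. *)
pose mu a := 4 * C * nu a.
have C4 : 0 < 4 * C by rewrite mulr_gt0.
have qrho : quasi_pseudometric (fun x y => mu (iY y - iY x)).
  apply: norm_quasi_pseudometric => [a||a b].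
  - by rewrite mulr_ge0// ltW.
  - by rewrite /mu nu0 mulr0.
  - by rewrite -mulrDr ler_pM2l.
have mun r : 0 < r -> nbhs 0 [set a | mu a < r].
  move=> r0; apply: filterS (nun (r / (4 * C)) _) => [a|]; last first.
    by rewrite divr_gt0.
  by rewrite /= ltr_pdivlMr// mulrC.
have drho x y : d x y <= mu (iY (\val y) - iY (\val x)).
  rewrite /mu -!eE -raddfB mulrAC -ler_pdivrMr//.
  apply: dyadic_le => // [|n /nuN /(NP n).2].
    by rewrite ler_pdivrMr// mul1r.
  by move=> /(graev_ball_dist freeX qd); rewrite ltr_pdivrMr// mulrC.
have [dY [qdY dYrho dYE]] := quasi_pseudometric_extension qd qrho drho.
exists dY; split=> //; apply/(qu_continuousP qdY) => x r r0.
apply: filterS (norm_ball_nbhs paraY ciY mun x r0) => y.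
exact: le_lt_trans.
Qed.

End Embedding.

Theorem theorem5p2 (R : realType) (Y : topologicalType) (X : set Y)
    (APX APY : PreTopologicalZmodule.type) (iX : X -> APX) (iY : Y -> APY)
    (e : {additive APX -> APY})
    (tychonoffY : tychonoff_space Y)
    (freeX : markov_free_abelian iX) (freeY : markov_free_abelian iY)
    (e_continuous : continuous e)
    (e_extends : forall x : X, e (iX x) = iY (\val x)) :
  topological_monomorphism e <-> quasi_Pstar_embedded R X.
Proof.
split; first exact: (topological_monomorphism_quasi_Pstar_embedded
  freeX freeY e_extends).
exact: (quasi_Pstar_embedded_topological_monomorphism freeX freeY e_extends).
Qed.
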